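(* Let $\mathcal{F}_5^{\mathrm{sp}}=\{K_6\}\cup\{J_i : 1\le i\le 12\}$. If $G$ is a split graph, then $G$ is star $5$-colorable if and only if $G$ is $\mathcal{F}_5^{\mathrm{sp}}$-free, that is, no induced subgraph of $G$ is isomorphic to a member of $\mathcal{F}_5^{\mathrm{sp}}$.
   Context: Graphs are finite, with no loops or parallel edges. A star coloring of $G$ is a proper vertex coloring in which no path on four vertices (as a not necessarily induced subgraph) uses only two colors; $G$ is star $k$-colorable if it has a star coloring using at most $k$ colors. A split graph is a graph whose vertex set can be partitioned into a clique $K$ and an independent set $S$. Each of $J_1,\dots,J_{12}$ is a split graph with clique $K=\{0,1,2,3,4\}$ and an independent set $S$ (disjoint from $K$) having exactly one vertex for each of the listed neighborhoods (subsets of $K$): $J_1$: $\{0,1,2,3\},\{4\}$; $J_2$: $\{0,1,2,3\},\{0,4\}$; $J_3$: $\{0,1,2,3\},\{0,1,4\}$; $J_4$: $\{0,1,2,3\},\{0,1,2,4\}$; $J_5$: $\{0,1,2\},\{3,4\}$; $J_6$: $\{0,1,2\},\{2,3,4\}$; $J_7$: $\{0,1,2\},\{0,1,3\},\{0,2,3\},\{4\}$; $J_8$: $\{0,1,2\},\{0,1,3\},\{0,2,3\},\{0,4\}$; $J_9$: $\{0,1,2\},\{0,1,3\},\{2,3\},\{4\}$; $J_{10}$: $\{0,1,2\},\{0,1,3\},\{2,3\},\{0,4\}$; $J_{11}$: $\{0,1,2\},\{0,3\},\{2,3\},\{1,4\}$; $J_{12}$: $\{0,1\},\{0,2\},\{1,2\},\{3,4\}$.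 *)

(* Defs.v *)
From mathcomp Require Import all_boot.

Set Implicit Arguments.
Unset Strict Implicit.
Unset Printing Implicit Defensive.

Record sgraph := SGraph {
  vertex :> finType;
  adj : rel vertex;
  adj_sym : symmetric adj;
  adj_irr : irreflexive adj
}.

Section GraphNotions.
Variable G : sgraph.

Definition clique (A : {set G}) : Prop :=
  {in A &, forall x y, x != y -> adj x y}.

Definition independent (A : {set G}) : Prop :=
  {in A &, forall x y, ~~ adj x y}.

(* Either part may be empty. *)
Definition split_graph : Prop :=
  exists K S : {set G},
    [/\ K :|: S = [set: G], K :&: S = set0, clique K & independent S].

Definition proper_coloring (C : finType) (f : G -> C) : Prop :=
  forall x y : G, adj x y -> f x != f y.

Definition star_coloring (C : finType) (f : G -> C) : Prop :=
  proper_coloring f /\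
  forall a b c d : G,
    uniq [:: a; b; c; d] -> path (@adj G) a [:: b; c; d] ->
    2 < #|f @: [set a; b; c; d]|.

Definition star_colorable (k : nat) : Prop :=
  exists f : G -> 'I_k, star_coloring f.

Section Induced.
Variable A : {set G}.

Definition induced_adj : rel {x : G | x \in A} :=
  fun x y => adj (val x) (val y).

Lemma induced_sym : symmetric induced_adj.
Proof. by move=> x y; apply: adj_sym. Qed.

Lemma induced_irr : irreflexive induced_adj.
Proof. by move=> x; apply: adj_irr. Qed.

Definition induced : sgraph := SGraph induced_sym induced_irr.

End Induced.
End GraphNotions.

Definition isomorphic (G H : sgraph) : Prop :=
  exists2 f : G -> H, bijective f & forall x y : G, adj (f x) (f y) = adj x y.

Definition free_of (F : sgraph -> Prop) (G : sgraph) : Prop :=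
  forall H : sgraph, F H -> ~ exists A : {set G}, isomorphic (induced A) H.

Section Complete.
Variable n : nat.

Definition complete_adj : rel 'I_n := fun i j => i != j.

Lemma complete_sym : symmetric complete_adj.
Proof. by move=> i j; rewrite /complete_adj eq_sym. Qed.

Lemma complete_irr : irreflexive complete_adj.
Proof. by move=> i; rewrite /complete_adj eqxx. Qed.

Definition complete : sgraph := SGraph complete_sym complete_irr.

End Complete.

(* [split_from n N] has clique {0, ..., n-1} (the left summand) and one
   independent vertex per position of [N], whose neighborhood is the entry of
   [N] at that position. *)
Section SplitFrom.
Variables (n : nat) (N : seq (seq nat)).

Definition split_from_adj : rel ('I_n + 'I_(size N))%type := fun u v =>
  match u, v with
  | inl i, inl j => i != j
  | inl i, inr s | inr s, inl i => val i \in nth [::] N s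
  | inr _, inr _ => false
  end.

Lemma split_from_sym : symmetric split_from_adj.
Proof. by case=> [i|s] [j|t] //=; rewrite eq_sym. Qed.

Lemma split_from_irr : irreflexive split_from_adj.
Proof. by case=> [i|s] //=; rewrite eqxx. Qed.

Definition split_from : sgraph := SGraph split_from_sym split_from_irr.

End SplitFrom.

Definition J_neighborhoods : seq (seq (seq nat)) :=
  [:: [:: [:: 0; 1; 2; 3]; [:: 4]];
      [:: [:: 0; 1; 2; 3]; [:: 0; 4]];
      [:: [:: 0; 1; 2; 3]; [:: 0; 1; 4]];
      [:: [:: 0; 1; 2; 3]; [:: 0; 1; 2; 4]];
      [:: [:: 0; 1; 2]; [:: 3; 4]];
      [:: [:: 0; 1; 2]; [:: 2; 3; 4]];
      [:: [:: 0; 1; 2]; [:: 0; 1; 3]; [:: 0; 2; 3]; [:: 4]];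
      [:: [:: 0; 1; 2]; [:: 0; 1; 3]; [:: 0; 2; 3]; [:: 0; 4]];
      [:: [:: 0; 1; 2]; [:: 0; 1; 3]; [:: 2; 3]; [:: 4]];
      [:: [:: 0; 1; 2]; [:: 0; 1; 3]; [:: 2; 3]; [:: 0; 4]];
      [:: [:: 0; 1; 2]; [:: 0; 3]; [:: 2; 3]; [:: 1; 4]];
      [:: [:: 0; 1]; [:: 0; 2]; [:: 1; 2]; [:: 3; 4]]].

(* [J i] is J_i for 1 <= i <= 12; the list above is indexed from 0. *)
Definition J (i : nat) : sgraph := split_from 5 (nth [::] J_neighborhoods i.-1).

Inductive F5sp : sgraph -> Prop :=
  | F5sp_K6 : F5sp (complete 6)
  | F5sp_J (i : nat) : 1 <= i <= 12 -> F5sp (J i).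

(* Main.v *)
Require Import Defs.
From mathcomp Require Import all_boot.

Set Implicit Arguments.
Unset Strict Implicit.
Unset Printing Implicit Defensive.

(** Let [G] be split into a clique [K] and an independent set.

    If [#|K| <= 4], give [K] distinct colors and all other vertices a fifth one;
    if [#|K| >= 6], then [K_6] is induced in [G].  So let [#|K| = 5].  The five
    colors then name the vertices of [K], and a bicolored path on four vertices
    must use two vertices [x], [y] of [K] and two vertices [u], [v] outside, in
    the order [u - y - x - v], where [u] has the color of [x] and [v] that of
    [y] ([star_coloring_split]).  Draw an arc from [x] to every neighbor of an
    outside vertex colored like [x]: such a path exists exactly when two arcs are
    opposite, and a loop means that the coloring is not proper.  Hence [G] is
    star 5-colorable iff [K] has an orientation in which each neighborhood of an
    outside vertex lies in an out-neighborhood; below, the family of these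
    neighborhoods is then called dominated.

    For [J_1, ..., J_12] at most [5 ^ 4] choices of colors outside the clique
    have to be excluded ([J_not_star_colorable]), and star colorability passes
    to induced subgraphs.

    Conversely, let [F] be a family of proper subsets of a 5-set that contains
    no copy of the neighborhood family of any [J_i].  Four orientations are
    enough to dominate it.
    - If [{0,1,2,3}] is in [F], then [J_1, ..., J_4] keep the vertex 4 out of
      every member of [F], and it suffices that 4 beats all others.
    - Two distinct 3-sets of [F] meet in two points, by [J_6].  If [F] contains
      [{0,1,2}] and [{0,1,3}], then either one of [{2,3}], [{0,2,3}], [{1,2,3}]
      is in [F], and [J_5, ..., J_10] again keep 4 out of every member; or each
      member lies in some [{0,1,x}], and the three other vertices, oriented
      as a cycle, can be given the out-neighborhoods [{0,1,x}]
      ([dominated_of_two_3sets]).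
    - Suppose that [{0,1,2}] is the only 3-set, or that there is no 3-set but
      [{0,1}], [{0,2}], [{1,2}] are in [F].  Then [{3,4}] is not in [F], by [J_5]
      or [J_12], and by [J_11] or [J_12] the pairs that join [{0,1,2}] to
      [{3,4}] either miss one of 0, 1, 2, so that the previous orientation works,
      or all contain the same vertex of [{3,4}], for which there is a third
      orientation ([dominated_of_triple]).
    - Otherwise [F] consists of sets of size at most one and of the edges of a
      triangle-free graph.  If three vertices span no edge, the two others meet
      every edge and the second orientation works; if there are no such three
      vertices, then the graph is a 5-cycle ([ramsey_pentagon]) and the
      rotational tournament works ([dominated_of_pairs]). *)

(** * Star colorings and induced subgraphs *)

Lemma embedding_induced (G H : sgraph) (h : H -> G) :
  injective h -> (forall x y, adj (h x) (h y) = adj x y) ->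
  exists A : {set G}, isomorphic (induced A) H.
Proof.
move=> h_inj h_adj; exists [set h x | x in H].
have memh (x : H) : h x \in [set h z | z in H] by apply: imset_f.
pose g (x : H) : {v : G | v \in [set h z | z in H]} := Sub (h x) (memh x).
have g_bij : bijective g.
  apply: inj_card_bij => [x y /(congr1 val)/h_inj // | ].
  by rewrite card_sig card_imset.
have [f gK fK] := g_bij.
exists f; first by exists g.
by move=> x y; rewrite -h_adj -{2}[x]fK -{2}[y]fK.
Qed.

Lemma star_colorable_sub (G H : sgraph) (h : H -> G) (k : nat) :
  injective h -> (forall x y, adj x y -> adj (h x) (h y)) ->
  star_colorable G k -> star_colorable H k.
Proof.
move=> h_inj h_adj [f [f_proper f_star]]; exists (f \o h); split.
  by move=> x y /h_adj/f_proper.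
move=> a b c d uniq_p path_p.
have -> : (f \o h) @: [set a; b; c; d] = f @: [set h a; h b; h c; h d].
  by rewrite imset_comp !imsetU !imset_set1.
apply: f_star; first by rewrite (map_inj_uniq h_inj [:: a; b; c; d]).
by case/and4P: path_p => /h_adj ab /h_adj bc /h_adj cd _; apply/and4P.
Qed.

Lemma star_colorable_induced (G H : sgraph) (A : {set G}) (k : nat) :
  isomorphic (induced A) H -> star_colorable G k -> star_colorable H k.
Proof.
case=> f [g fK gK] f_adj.
apply: (star_colorable_sub (h := fun x => val (g x))).
  by move=> x y /val_inj/(can_inj gK).
by move=> x y; rewrite -{1}[x]gK -{1}[y]gK f_adj.
Qed.

(** In a proper coloring, two colors on a path must alternate. *)
Lemma two_coloredP (G : sgraph) (C : finType) (f : G -> C) a b c d :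
  proper_coloring f -> path (@adj G) a [:: b; c; d] ->
  #|f @: [set a; b; c; d]| <= 2 -> f a = f c /\ f b = f d.
Proof.
move=> f_proper /and4P[/f_proper ab /f_proper bc /f_proper cd _] le2.
have no3 x y z : x \in [set a; b; c; d] -> y \in [set a; b; c; d] ->
    z \in [set a; b; c; d] -> uniq [:: f x; f y; f z] -> False.
  move=> xP yP zP /card_uniqP card3; move: le2; rewrite leqNgt => /negP; apply.
  rewrite -[2.+1]card3; apply/subset_leq_card/subsetP=> w.
  by rewrite !inE => /or3P[] /eqP->; apply: imset_f.
split; apply/eqP/negPn/negP=> neq.
  by apply: (no3 a b c); rewrite ?inE ?eqxx ?orbT //= !inE negb_or ab bc neq.
by apply: (no3 b c d); rewrite ?inE ?eqxx ?orbT //= !inE negb_or bc cd neq.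
Qed.

(** Of two vertices of the same color on a bicolored path on four vertices, at
    most one is in the clique, and consecutive vertices are not both outside.
    So the ends are outside and the middle is in the clique, which is the
    configuration excluded by the last hypothesis.  Its case [u = v], [x = y]
    makes [f] proper. *)
Lemma star_coloring_split (G : sgraph) (K : {set G}) (C : finType) (f : G -> C) :
  clique K -> independent (~: K) -> {in K &, injective f} ->
  (forall u v x y, u \notin K -> v \notin K -> x \in K -> y \in K ->
     adj u y -> adj v x -> f u = f x -> f v = f y -> False) ->
  star_coloring f.
Proof.
move=> clK indS f_inj noclash.
have outin u x : adj u x -> u \notin K -> x \in K.
  move=> ux uS; apply/negPn/negP=> xS.
  by have := indS u x; rewrite !inE ux => /(_ uS xS).
have f_proper : proper_coloring f.
  move=> u x ux; apply/eqP=> fux.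
  have xu : adj x u by rewrite adj_sym.
  have [uK|uS] := boolP (u \in K); last first.
    by apply: (noclash u u x x) => //; apply: outin ux _.
  have [xK|xS] := boolP (x \in K); last by apply: (noclash x x u u).
  by move: ux; rewrite (f_inj u x) // adj_irr.
split=> // a b c d uniq_p path_p; rewrite ltnNge; apply/negP.
case/(two_coloredP f_proper path_p) => fac fbd.
have /and4P[ab bc cd _] := path_p.
have ac : a != c by move: uniq_p; rewrite /= !inE !negb_or => /andP[/and3P[]].
have bd : b != d.
  by move: uniq_p; rewrite /= !inE !negb_or => /and3P[_ /andP[]].
have [aK|aS] := boolP (a \in K).
  have cS : c \notin K by apply/negP=> cK; rewrite (f_inj a c) ?eqxx in ac.
  have bK : b \in K by apply: outin cS; rewrite adj_sym.
  have dK : d \in K by apply: outin cS.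
  by rewrite (f_inj b d) ?eqxx in bd.
have bK := outin _ _ ab aS.
have dS : d \notin K by apply/negP=> dK; rewrite (f_inj b d) ?eqxx in bd.
have dc : adj d c by rewrite adj_sym.
exact: (noclash a d c b aS dS (outin _ _ dc dS) bK ab dc fac (esym fbd)).
Qed.

(** A bicolored path would need a color that occurs both inside and outside [K];
    here all outside vertices share a color that is absent from [K]. *)
Lemma star_colorable_small_clique (G : sgraph) (K : {set G}) (k : nat) :
  clique K -> independent (~: K) -> #|K| <= k -> star_colorable G k.+1.
Proof.
move=> clK indS leK.
have rank_lt x : x \in K -> index x (enum K) < k.
  by move=> xK; apply: leq_trans leK; rewrite cardE index_mem mem_enum.
pose f (v : G) : 'I_k.+1 :=
  if v \in K then inord (index v (enum K)) else ord_max.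
have fK x : x \in K -> f x = index x (enum K) :> nat.
  by move=> xK; rewrite /f xK inordK // ltnW // ltnS rank_lt.
exists f; apply: (star_coloring_split clK indS).
  move=> x y xK yK /(congr1 val); rewrite /= !fK //.
  move=> /(congr1 (nth x (enum K))).
  by rewrite !nth_index ?mem_enum.
move=> u v x y uS _ xK _ _ _ /(congr1 val).
rewrite /= (fK x) // /f (negbTE uS) /= => eqk.
by have := rank_lt x xK; rewrite -eqk ltnn.
Qed.

Lemma complete_not_star_colorable (n k : nat) :
  k < n -> ~ star_colorable (complete n) k.
Proof.
move=> lt_kn [f [f_proper _]].
have f_inj : injective f.
  move=> i j fij; apply/eqP/negPn/negP=> ij.
  by have := f_proper i j ij; rewrite fij eqxx.
by have := leq_card f f_inj; rewrite !card_ord leqNgt lt_kn.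
Qed.

Lemma large_clique_induced (G : sgraph) (K : {set G}) (n : nat) :
  clique K -> n <= #|K| ->
  exists A : {set G}, isomorphic (induced A) (complete n).
Proof.
move=> clK leK; pose h (i : 'I_n) : G := enum_val (widen_ord leK i).
have h_inj : injective h.
  by move=> i j /enum_val_inj/(congr1 val)/= ij; apply: val_inj.
apply: (embedding_induced (h := (h : complete n -> G))) => // i j.
rewrite /= /complete_adj; have [->|neq] := eqVneq i j; first exact: adj_irr.
by apply: clK; rewrite ?enum_valP // (inj_eq h_inj).
Qed.

Fixpoint choices (k : nat) : seq (seq nat) :=
  if k is k'.+1 then [seq i :: c | i <- iota 0 5, c <- choices k']
  else [:: [::]].

(** [c] gives the outside vertex with neighborhood [nth [::] N s] the color of
    the clique vertex [nth 0 c s].  A clash with [s = t] is a failure to be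
    proper; a clash with [s != t] closes a bicolored path. *)
Definition clash (N : seq (seq nat)) (c : seq nat) : bool :=
  has (fun s => has (fun t => (nth 0 c t \in nth [::] N s) &&
                              (nth 0 c s \in nth [::] N t))
                    (iota 0 (size N)))
      (iota 0 (size N)).

Lemma mem_choices (c : seq nat) :
  all (fun i => i < 5) c -> c \in choices (size c).
Proof.
elim: c => [|i c IHc] // /andP[lti /IHc cP].
by apply: allpairs_f; rewrite ?mem_iota.
Qed.

(** A star coloring is injective on the clique, so the clique uses all five
    colors, and every outside vertex is colored like some clique vertex. *)
Lemma split_from_not_star_colorable (N : seq (seq nat)) :
  all (clash N) (choices (size N)) -> ~ star_colorable (split_from 5 N) 5.
Proof.
move=> /allP all_clash [f [f_proper f_star]].
have f_inj : injective (fun i : 'I_5 => f (inl i)).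
  move=> i j fij; apply/eqP/negPn/negP=> ij.
  by have := f_proper (inl i) (inl j) ij; rewrite fij eqxx.
have [g _ gK] := injF_bij f_inj.
pose c := [seq val (g (f (inr s))) | s <- enum 'I_(size N)].
have cE (s : 'I_(size N)) : nth 0 c s = g (f (inr s)).
  by rewrite (nth_map s) ?nth_ord_enum // size_enum_ord.
have size_c : size c = size N by rewrite size_map size_enum_ord.
have /all_clash : c \in choices (size N).
  rewrite -size_c mem_choices //.
  by apply/allP=> _ /mapP[s _ ->]; apply: ltn_ord.
case/hasP=> s; rewrite mem_iota /= add0n => ltsN.
case/hasP=> t; rewrite mem_iota /= add0n => lttN.
rewrite (cE (Ordinal ltsN)) (cE (Ordinal lttN)).
set x := g _; set y := g _; move=> /andP[xs yt].
have fx : f (inl x) = f (inr (Ordinal lttN)) by rewrite gK.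
have fy : f (inl y) = f (inr (Ordinal ltsN)) by rewrite gK.
have proper_own (r : 'I_(size N)) (z : 'I_5) :
    f (inl z) = f (inr r) -> val z \notin nth [::] N r.
  move=> fz; apply/negP=> zr.
  by have := f_proper (inl z) (inr r) zr; rewrite fz eqxx.
have xy : x != y.
  by apply: contraL xs => /eqP->; apply: (proper_own (Ordinal ltsN)).
have st : Ordinal ltsN != Ordinal lttN.
  by apply: contraL xs => /eqP[->]; apply: (proper_own (Ordinal lttN)).
have := f_star (inr (Ordinal ltsN)) (inl x) (inl y) (inr (Ordinal lttN)).
rewrite /= xs yt xy !inE !orbF /= => /(_ _ isT).
have -> : (inr (Ordinal ltsN) == inr (Ordinal lttN)
             :> 'I_5 + 'I_(size N)) = false.
  by apply/negbTE.
rewrite (inj_eq (@inl_inj _ _)) xy => /(_ isT).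
rewrite ltnNge => /negP; apply; rewrite !imsetU !imset_set1 fx fy.
by rewrite -setUA setUid cards2; case: (_ != _).
Qed.

Lemma J_not_star_colorable (i : nat) : 1 <= i <= 12 -> ~ star_colorable (J i) 5.
Proof.
move=> le_i; apply: split_from_not_star_colorable.
by move: i le_i; do 13 case=> //.
Qed.

(** * Orientations of the complete graph on five vertices *)

(** An orientation is given by its list of out-neighborhoods on
    [0, ..., 4]; pairs of vertices may be left without an arc. *)
Definition hub_orientation : seq (seq nat) :=
  [:: [::]; [::]; [::]; [::]; [:: 0; 1; 2; 3]].

(** Every set with at most one element outside [{0,1}] lies in one of the three
    nonempty out-neighborhoods. *)
Definition pair_orientation : seq (seq nat) :=
  [:: [::]; [::]; [:: 0; 1; 4]; [:: 0; 1; 2]; [:: 0; 1; 3]].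

(** This dominates [{0,1,2}], the three pairs [{i,3}] with [i < 3], and [{4}]. *)
Definition triple_orientation : seq (seq nat) :=
  [:: [:: 2; 3]; [:: 0; 3]; [:: 1; 3]; [:: 4]; [:: 0; 1; 2]].

(** This dominates the edges of the 5-cycle [0 - 1 - 2 - 3 - 4]. *)
Definition cyclic_orientation : seq (seq nat) :=
  [:: [:: 1; 2]; [:: 2; 3]; [:: 3; 4]; [:: 4; 0]; [:: 0; 1]].

Definition orientations : seq (seq (seq nat)) :=
  [:: hub_orientation; pair_orientation;
      triple_orientation; cyclic_orientation].

Lemma orientations_asym out : out \in orientations ->
  forall i j, j \in nth [::] out i -> i \notin nth [::] out j.
Proof.
have size5 i j : j \in nth [::] out i -> i < size out.
  by rewrite ltnNge; apply: contraL => /(nth_default [::])->.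
have : all (fun o : seq (seq nat) => all (fun i => all (fun j =>
    (j \in nth [::] o i) ==> (i \notin nth [::] o j)) (iota 0 (size o)))
    (iota 0 (size o))) orientations by [].
move=> /allP asym /asym {}asym i j ji; apply/negP=> ij.
move: asym => /allP /(_ i); rewrite mem_iota (size5 _ _ ji) => /(_ isT).
by move=> /allP /(_ j); rewrite mem_iota (size5 _ _ ij) ji ij => /(_ isT).
Qed.

Lemma orientations_lt5 out i j :
  out \in orientations -> j \in nth [::] out i -> j < 5.
Proof.
have /allP bound : all (all (all (fun k => k < 5))) orientations by [].
move=> /bound/allP out5; have [lti|gei] := ltnP i (size out).
  by apply: (allP (out5 _ (mem_nth [::] lti))).
by rewrite nth_default.
Qed.

Fixpoint sublists (s : seq nat) : seq (seq nat) :=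
  if s is i :: s' then [seq i :: n | n <- sublists s'] ++ sublists s'
  else [:: [::]].

Lemma filter_sublists (p : pred nat) s : [seq i <- s | p i] \in sublists s.
Proof.
elim: s => //= i s IHs; rewrite mem_cat; case: (p i); last by rewrite IHs orbT.
by rewrite map_f.
Qed.

(** The family [I] of subsets of [0, ..., 4] contains the neighborhood family
    of some [J_i], up to a permutation of the five points. *)
Definition contains_J (I : seq (seq nat)) : bool :=
  has (fun N => has (fun p =>
         all (fun n => has (perm_eq (map (nth 0 p) n)) I) N)
       (permutations (iota 0 5)))
    J_neighborhoods.

(** [n] lies in an out-neighborhood of the orientation [out] transported along
    the permutation [p]. *)
Definition covered (p : seq nat) (out : seq (seq nat)) (n : seq nat) : bool :=
  has (fun i => all (mem (map (nth 0 p) (nth [::] out i))) n) (iota 0 5).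

(** Three pairs between [{0,1,2}] and [{3,4}] that cover [{0,1,2}], two of them
    with the same element of [{3,4}] and one with the other.  Together with
    [{0,1,2}] they are a copy of the family of [J_11]; together with the pairs
    in [{0,1,2}] they contain a copy of the family of [J_12]. *)
Definition crosses : seq (seq (seq nat)) :=
  [:: [:: [:: 0; 3]; [:: 1; 3]; [:: 2; 4]];
      [:: [:: 0; 4]; [:: 1; 4]; [:: 2; 3]];
      [:: [:: 0; 3]; [:: 2; 3]; [:: 1; 4]];
      [:: [:: 0; 4]; [:: 2; 4]; [:: 1; 3]];
      [:: [:: 1; 3]; [:: 2; 3]; [:: 0; 4]];
      [:: [:: 1; 4]; [:: 2; 4]; [:: 0; 3]]].

(** By [J_6] these are the only 3-sets that can accompany [{0,1,2}]. *)
Definition adjacent_triples : seq (seq nat) :=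
  [:: [:: 0; 1; 3]; [:: 0; 2; 3]; [:: 1; 2; 3];
      [:: 0; 1; 4]; [:: 0; 2; 4]; [:: 1; 2; 4]].

Lemma perm_map_nth (T : eqType) (x0 : T) (s : seq T) (p : seq nat) :
  perm_eq p (iota 0 (size s)) -> perm_eq (map (nth x0 s) p) s.
Proof. by move/(perm_map (nth x0 s)); rewrite map_nth_iota0 // take_size. Qed.

(** For symmetric [g] this is the extremal case of [R(3,3) = 6].  Among five vertices without a triangle
    and without three pairwise nonadjacent ones, each vertex has exactly two
    neighbors, because three neighbors, or three nonneighbors, would produce one
    or the other.  A 2-regular graph on five vertices without a triangle is a
    5-cycle.  The conclusion lists the nonadjacent pairs of the cycle
    [a - b - c - d - e]. *)
Lemma ramsey_pentagon (T : eqType) (g : rel T) (s : seq T) :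
  uniq s -> size s = 5 ->
  (forall x y z, x \in s -> y \in s -> z \in s -> uniq [:: x; y; z] ->
     [|| g x y, g x z | g y z] && ~~ [&& g x y, g x z & g y z]) ->
  exists a b c d e, perm_eq [:: a; b; c; d; e] s /\
    [/\ ~~ g a c, ~~ g b d, ~~ g c e, ~~ g a d & ~~ g b e].
Proof.
move=> s_uniq s5 mixed.
have mixed5 a b c d e : perm_eq [:: a; b; c; d; e] s ->
    [|| g a b, g a c | g b c] && ~~ [&& g a b, g a c & g b c].
  move=> ps; apply: mixed; rewrite -?(perm_mem ps) ?inE ?eqxx ?orbT //.
  move: s_uniq; rewrite -(perm_uniq ps) /= !inE !negb_or.
  by case/and5P=> /and4P[-> -> _ _] /and3P[-> _ _].
(* The neighbors of [a] are [b] and [e]; the cycle closes through [c], [d] in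
   one of the two orders. *)
have pentagon_at a b c d e : perm_eq [:: a; b; c; d; e] s ->
    g a b -> g a e -> ~~ g a c -> ~~ g a d -> exists a b c d e,
    perm_eq [:: a; b; c; d; e] s /\
    [/\ ~~ g a c, ~~ g b d, ~~ g c e, ~~ g a d & ~~ g b e].
  move=> ps ab ae ac ad.
  have reorder p : perm_eq p (iota 0 5) ->
      perm_eq (map (nth a [:: a; b; c; d; e]) p) s.
    by move=> /(@perm_map_nth _ a [:: a; b; c; d; e])/perm_trans; apply.
  have /mixed5 := reorder [:: 0; 2; 3; 1; 4] isT.
  rewrite (negbTE ac) (negbTE ad) /= => /andP[cd _].
  have /mixed5 := reorder [:: 0; 1; 4; 2; 3] isT.
  rewrite ab ae /= => nbe.
  have /mixed5 := reorder [:: 1; 2; 3; 0; 4] isT.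
  have /mixed5 := reorder [:: 2; 3; 4; 0; 1] isT.
  have /mixed5 := reorder [:: 1; 2; 4; 0; 3] isT.
  have /mixed5 := reorder [:: 1; 3; 4; 0; 2] isT.
  rewrite cd (negbTE nbe) => bde bce cde bcd.
  have [bd|nbd] := boolP (g b d).
    exists a, b, d, c, e; split; first exact: (reorder [:: 0; 1; 3; 2; 4]).
    split=> //; move: bde bce cde bcd; rewrite bd;
      by case: (g b c); case: (g c e); case: (g d e).
  exists a, b, c, d, e; split=> //; split=> //; move: bde bce cde bcd.
  by rewrite (negbTE nbd); case: (g b c); case: (g c e); case: (g d e).
case: s s5 s_uniq mixed mixed5 pentagon_at => [|a [|b [|c [|d [|e []]]]]] // _ _ _.
set s := [:: a; b; c; d; e] => mixed5 pentagon_at.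
have reorder p : perm_eq p (iota 0 5) -> perm_eq (map (nth a s) p) s.
  exact: (@perm_map_nth _ a s).
(* It remains to see that [a] has exactly two neighbors: in the 10 remaining
   cases for its neighbors the other six pairs contradict the ten conditions
   on triples. *)
have := pentagon_at a b c d e (reorder [:: 0; 1; 2; 3; 4] isT).
have := pentagon_at a b c e d (reorder [:: 0; 1; 2; 4; 3] isT).
have := pentagon_at a b d e c (reorder [:: 0; 1; 3; 4; 2] isT).
have := pentagon_at a c b d e (reorder [:: 0; 2; 1; 3; 4] isT).
have := pentagon_at a c b e d (reorder [:: 0; 2; 1; 4; 3] isT).
have := pentagon_at a d b c e (reorder [:: 0; 3; 1; 2; 4] isT).
have /mixed5 := reorder [:: 0; 1; 2; 3; 4] isT.
have /mixed5 := reorder [:: 0; 1; 3; 2; 4] isT.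
have /mixed5 := reorder [:: 0; 1; 4; 2; 3] isT.
have /mixed5 := reorder [:: 0; 2; 3; 1; 4] isT.
have /mixed5 := reorder [:: 0; 2; 4; 1; 3] isT.
have /mixed5 := reorder [:: 0; 3; 4; 1; 2] isT.
have /mixed5 := reorder [:: 1; 2; 3; 0; 4] isT.
have /mixed5 := reorder [:: 1; 2; 4; 0; 3] isT.
have /mixed5 := reorder [:: 1; 3; 4; 0; 2] isT.
have /mixed5 := reorder [:: 2; 3; 4; 0; 1] isT.
case: (g a b); case: (g a c); case: (g a d); case: (g a e) => /=;
  case: (g b c) => //=; case: (g b d) => //=; case: (g b e) => //=;
  case: (g c d) => //=; case: (g c e) => //=; case: (g d e) => //= *; eauto.
Qed.

(** A certificate that [out], transported along [p], dominates every family which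
    is free of the [J_i], contains all sets in [I] and none in [O], and has only
    members that satisfy [ok]: each set not excluded by [O] and [ok] is dominated
    or would complete a copy of some [J_i] together with [I]. *)
Definition settled (p : seq nat) (out I O : seq (seq nat))
    (ok : pred (seq nat)) : bool :=
  [&& perm_eq p (iota 0 5), out \in orientations &
      all (fun n => ok n && (n \notin O) ==>
                    covered p out n || contains_J (n :: I))
          (sublists (iota 0 5))].

Section Families.

Variables (T : finType) (x0 : T) (K : {set T}) (F : {set {set T}}).
Implicit Types (s : seq T) (n p : seq nat) (I : seq (seq nat)).

(** The elements of [K] are named [0, ..., 4] by their positions in a listing.
    A choice of names without loss of generality is the choice of a listing. *)
Definition listing s : bool := perm_eq s (enum K).

Definition part s n : {set T} := [set x in map (nth x0 s) n].

Definition fam s n : bool := part s n \in F.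

Definition J_free : Prop :=
  forall N s, N \in J_neighborhoods -> listing s -> ~~ all (fam s) N.

(** The listing [s] transports the orientation [out] to [K]; the four fixed
    orientations turn out to suffice. *)
Definition dominated : Prop :=
  exists s, exists2 out, listing s /\ out \in orientations &
    forall B, B \in F -> exists2 i, i < 5 & B \subset part s (nth [::] out i).

Hypothesis card_K : #|K| = 5.
Hypothesis F_sub : forall B, B \in F -> B \proper K.
Hypothesis F_free : J_free.

Lemma size_listing s : listing s -> size s = 5.
Proof. by move/perm_size->; rewrite -cardE. Qed.

Lemma mem_listing s : listing s -> s =i K.
Proof. by move=> /perm_mem sK x; rewrite sK mem_enum. Qed.

Lemma uniq_listing s : listing s -> uniq s.
Proof. by move/perm_uniq->; rewrite enum_uniq. Qed.

Definition relist s p : seq T := map (nth x0 s) p.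

Lemma listing_relist s p :
  perm_eq p (iota 0 5) -> listing s -> listing (relist s p).
Proof.
move=> pP sK; apply: (perm_trans _ sK); apply: perm_map_nth.
by rewrite (size_listing sK).
Qed.

Lemma fam_eq s n m : n =i m -> fam s n = fam s m.
Proof.
by move=> nm; congr (_ \in F); apply/setP=> x; rewrite !inE; apply: eq_mem_map.
Qed.

Lemma fam_relist s p n : all (fun i => i < size p) n ->
  fam (relist s p) n = fam s (map (nth 0 p) n).
Proof.
move=> /allP n5; congr (_ \in F); apply/setP=> x; rewrite !inE -map_comp.
by congr (_ \in _); apply/eq_in_map => i /n5 lti; rewrite (nth_map 0).
Qed.

Lemma contains_J_false s I : listing s -> contains_J I -> ~~ all (fam s) I.
Proof.
move=> sK /hasP[N NJ /hasP[p]]; rewrite mem_permutations => pP NI.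
apply: contra (F_free NJ (listing_relist pP sK)) => /allP IF.
apply/allP=> n nN; have := allP NI n nN => /hasP[m mI /perm_mem nm].
have /allP/(_ N NJ)/allP/(_ n nN) n5 :
  all (all (all (fun i => i < 5))) J_neighborhoods by [].
by rewrite fam_relist ?(perm_size pP) // (fam_eq s nm) IF.
Qed.

Lemma part_of_set s (B : {set T}) : listing s -> B \subset K ->
  B = part s [seq i <- iota 0 5 | nth x0 s i \in B].
Proof.
move=> sK /subsetP BK; apply/setP=> x; rewrite inE; apply/idP/mapP.
  move=> xB; have xs : x \in s by rewrite (mem_listing sK) BK.
  exists (index x s); last by rewrite nth_index.
  by rewrite mem_filter nth_index // xB mem_iota -(size_listing sK) index_mem.
by case=> i; rewrite mem_filter => /andP[+ _ ->].
Qed.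

(** Every case of the argument ends here: the facts on [F] that define the case
    are [I], [O] and [ok], and the remaining condition is computed over the 32
    subsets of the five positions. *)
Lemma settle s p out I O (ok : pred (seq nat)) :
  listing s -> (forall n, n \in sublists (iota 0 5) -> fam s n -> ok n) ->
  all (fam s) I && all (fun n => ~~ fam s n) O -> settled p out I O ok ->
  dominated.
Proof.
move=> sK F_ok /andP[FI /allP FO] /and3P[pP outP /allP checked].
exists (relist s p); exists out => [|B BF]; first by rewrite listing_relist.
have BK := proper_sub (F_sub BF).
have := part_of_set sK BK; set n := filter _ _ => Bn.
have nP : n \in sublists (iota 0 5) by apply: filter_sublists.
have nF : fam s n by rewrite /fam -Bn.
have nO : n \notin O by apply/negP=> /FO; rewrite nF.
have := checked n nP; rewrite (F_ok n nP nF) nO => /orP[|/(contains_J_false sK)].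
  move=> /hasP[i]; rewrite mem_iota => i5 /allP n_out; exists i => //.
  rewrite {1}Bn; apply/subsetP=> x; rewrite !inE => /mapP[j /n_out jn ->].
  case/mapP: jn => k kP ->; apply/mapP; exists k => //.
  have kp : k < size p.
    by rewrite (perm_size pP) (orientations_lt5 outP kP).
  by rewrite (nth_map 0).
by rewrite /= nF FI.
Qed.

Lemma size_part s n : listing s -> n \in sublists (iota 0 5) -> #|part s n| = size n.
Proof.
move=> sK nP; have /andP[/allP n5 n_uniq] : all (fun i => i < 5) n && uniq n.
  by move: n nP; apply/allP.
rewrite cardsE (card_uniqP _) ?size_map // map_inj_in_uniq //.
move=> i j /n5 i5 /n5 j5 /eqP.
by rewrite nth_uniq ?(uniq_listing sK) ?(size_listing sK) // => /eqP.
Qed.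

Lemma listing_extend (t : seq T) : uniq t -> {subset t <= K} ->
  exists u, listing (t ++ u).
Proof.
move=> t_uniq tK; exists [seq x <- enum K | x \notin t].
apply: uniq_perm; rewrite ?enum_uniq //.
  rewrite cat_uniq t_uniq filter_uniq ?enum_uniq // andbT.
  by apply/hasPn=> x; rewrite mem_filter => /andP[].
move=> x; rewrite mem_cat mem_filter !mem_enum.
by case: (boolP (x \in t)) => //= /tK->.
Qed.

Lemma listing_of_set (B : {set T}) (k : nat) : B \subset K -> #|B| = k ->
  exists2 s, listing s & B = part s (iota 0 k).
Proof.
move=> /subsetP BK Bk.
have enumBK : {subset enum B <= K} by move=> x; rewrite mem_enum; apply: BK.
have [u uK] := listing_extend (enum_uniq _) enumBK.
exists (enum B ++ u) => //; rewrite /part map_nth_iota0; last first.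
  by rewrite size_cat -Bk cardE leq_addr.
rewrite -Bk cardE take_size_cat //.
by apply/setP=> x; rewrite inE mem_enum.
Qed.

Lemma size_bound s k n : (forall B, B \in F -> #|B| <= k) -> listing s ->
  n \in sublists (iota 0 5) -> fam s n -> size n <= k.
Proof. by move=> Fk sK nP nF; rewrite -(size_part sK nP) Fk. Qed.

Lemma dominated_of_4set s : listing s -> fam s [:: 0; 1; 2; 3] -> dominated.
Proof.
move=> sK f0123.
have F4 B : B \in F -> #|B| <= 4 by move/F_sub/proper_card; rewrite card_K.
apply: (@settle s (iota 0 5) hub_orientation [:: [:: 0; 1; 2; 3]] [::] _ sK
          (fun n => size_bound F4 sK)); last by lazy.
by rewrite /= f0123.
Qed.

(** In the first three cases the vertex 4 is in no member of [F]; in the last one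
    every member has at most one element outside [{0,1}]. *)
Lemma dominated_of_two_3sets s : (forall B, B \in F -> #|B| <= 3) -> listing s ->
  fam s [:: 0; 1; 2] -> fam s [:: 0; 1; 3] -> dominated.
Proof.
move=> F3 sK f012 f013.
have F_ok n := size_bound (n := n) F3 sK.
pose I n := [:: [:: 0; 1; 2]; [:: 0; 1; 3]; n].
have [f023|nf023] := boolP (fam s [:: 0; 2; 3]).
  apply: (@settle s (iota 0 5) hub_orientation (I [:: 0; 2; 3]) [::] _ sK F_ok);
    last by lazy.
  by rewrite /= f012 f013 f023.
have [f123|nf123] := boolP (fam s [:: 1; 2; 3]).
  apply: (@settle s (iota 0 5) hub_orientation (I [:: 1; 2; 3]) [::] _ sK F_ok);
    last by lazy.
  by rewrite /= f012 f013 f123.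
have [f23|nf23] := boolP (fam s [:: 2; 3]).
  apply: (@settle s (iota 0 5) hub_orientation (I [:: 2; 3]) [::] _ sK F_ok);
    last by lazy.
  by rewrite /= f012 f013 f23.
apply: (@settle s (iota 0 5) pair_orientation [:: [:: 0; 1; 2]; [:: 0; 1; 3]]
  [:: [:: 2; 3]; [:: 0; 2; 3]; [:: 1; 2; 3]] _ sK F_ok); last by lazy.
by rewrite /= f012 f013 nf23 nf023 nf123.
Qed.

(** If for some [i < 3] neither [{i,3}] nor [{i,4}] is in [F], all members of [F]
    have at most one element outside [{0,1,2}] minus [i].  Otherwise, each of
    0, 1, 2 is in a pair with 3 or 4, and since there is no cross, all these
    pairs contain 3 or all of them contain 4. *)
Lemma dominated_of_triple s : listing s ->
  (forall n, n \in sublists (iota 0 5) -> fam s n ->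
     (n == [:: 0; 1; 2]) || (size n <= 2)) ->
  ~~ fam s [:: 3; 4] -> all (fun I => ~~ all (fam s) I) crosses ->
  dominated.
Proof.
move=> sK F_ok nf34 no_cross.
have settle_pair p O : all (fun n => ~~ fam s n) O ->
    settled p pair_orientation [::] ([:: 3; 4] :: O)
      (fun n => (n == [:: 0; 1; 2]) || (size n <= 2)) -> dominated.
  by move=> FO; apply: (settle sK F_ok); rewrite /= nf34.
have [nf0|f0] := boolP (all (fun n => ~~ fam s n) [:: [:: 0; 3]; [:: 0; 4]]).
  by apply: (settle_pair [:: 1; 2; 0; 3; 4]) nf0 _; lazy.
have [nf1|f1] := boolP (all (fun n => ~~ fam s n) [:: [:: 1; 3]; [:: 1; 4]]).
  by apply: (settle_pair [:: 0; 2; 1; 3; 4]) nf1 _; lazy.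
have [nf2|f2] := boolP (all (fun n => ~~ fam s n) [:: [:: 2; 3]; [:: 2; 4]]).
  by apply: (settle_pair (iota 0 5)) nf2 _; lazy.
have settle_triple p O : all (fun n => ~~ fam s n) O ->
    settled p triple_orientation [::] ([:: 3; 4] :: O)
      (fun n => (n == [:: 0; 1; 2]) || (size n <= 2)) -> dominated.
  by move=> FO; apply: (settle sK F_ok); rewrite /= nf34.
have [nf4|f4] :=
    boolP (all (fun n => ~~ fam s n) [:: [:: 0; 4]; [:: 1; 4]; [:: 2; 4]]).
  by apply: (settle_triple (iota 0 5)) nf4 _; lazy.
have [nf3|f3] :=
    boolP (all (fun n => ~~ fam s n) [:: [:: 0; 3]; [:: 1; 3]; [:: 2; 3]]).
  by apply: (settle_triple [:: 0; 1; 2; 4; 3]) nf3 _; lazy.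
exfalso; move: no_cross f0 f1 f2 f3 f4; rewrite /=.
by case: (fam s [:: 0; 3]); case: (fam s [:: 1; 3]); case: (fam s [:: 2; 3]);
  do 3 case: (fam _ _).
Qed.

Lemma dominated_of_3set s : (forall B, B \in F -> #|B| <= 3) -> listing s ->
  fam s [:: 0; 1; 2] -> dominated.
Proof.
move=> F3 sK f012.
have [/hasP[n n_adj f_n]|no_adj] := boolP (has (fam s) adjacent_triples).
  (* A permutation that fixes [{0,1,2}] takes [{0,1,3}] to the second 3-set. *)
  have : all (fun m => has (fun p =>
      perm_eq (map (nth 0 p) [:: 0; 1; 2]) [:: 0; 1; 2] &&
      perm_eq (map (nth 0 p) [:: 0; 1; 3]) m) (permutations (iota 0 5)))
    adjacent_triples by lazy.
  move=> /allP/(_ n n_adj)/hasP[p]; rewrite mem_permutations => pP.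
  case/andP=> /perm_mem p012 /perm_mem p013.
  apply: (dominated_of_two_3sets F3 (listing_relist pP sK)).
    by rewrite fam_relist ?(perm_size pP) // (fam_eq s p012).
  by rewrite fam_relist ?(perm_size pP) // (fam_eq s p013).
have absent n : contains_J [:: [:: 0; 1; 2]; n] -> ~~ fam s n.
  by move/(contains_J_false sK); rewrite /= f012 andbT.
apply: (dominated_of_triple sK).
- move=> n nP nF.
  have : all (fun m => [|| 3 < size m, m \in adjacent_triples,
                          contains_J [:: [:: 0; 1; 2]; m],
                          m == [:: 0; 1; 2] | size m <= 2])
             (sublists (iota 0 5)) by lazy.
  move/allP/(_ n nP); rewrite ltnNge (size_bound F3 sK nP nF) /=.
  case/or3P=> [n_adj||//].
    by case/negP: no_adj; apply/hasP; exists n.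
  by move/absent; rewrite nF.
- by apply: absent; lazy.
- have : all (fun I => contains_J ([:: 0; 1; 2] :: I)) crosses by lazy.
  by apply: sub_all => I /(contains_J_false sK); rewrite /= f012.
Qed.

Lemma dominated_of_triangle s : (forall B, B \in F -> #|B| <= 2) -> listing s ->
  fam s [:: 0; 1] -> fam s [:: 0; 2] -> fam s [:: 1; 2] -> dominated.
Proof.
move=> F2 sK f01 f02 f12.
have absent I : contains_J [:: [:: 0; 1], [:: 0; 2], [:: 1; 2] & I] ->
    ~~ all (fam s) I.
  by move/(contains_J_false sK); rewrite /= f01 f02 f12.
apply: (dominated_of_triple sK).
- by move=> n nP nF; rewrite (size_bound F2 sK nP nF) orbT.
- by rewrite -[fam _ _]andbT; apply: (absent [:: [:: 3; 4]]); lazy.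
- have : all (fun I => contains_J [:: [:: 0; 1], [:: 0; 2], [:: 1; 2] & I])
             crosses by lazy.
  by apply: sub_all => I /absent.
Qed.

Lemma dominated_of_pairs : (forall B, B \in F -> #|B| <= 2) -> dominated.
Proof.
move=> F2; pose g x y := [set x; y] \in F.
have fam2 s i j : fam s [:: i; j] = g (nth x0 s i) (nth x0 s j).
  by congr (_ \in F); apply/setP=> x; rewrite !inE.
have extend x y z : x \in K -> y \in K -> z \in K -> uniq [:: x; y; z] ->
    exists u, listing [:: x, y, z & u].
  move=> xK yK zK /listing_extend; apply=> w.
  by rewrite !inE => /or3P[]/eqP->.
pose mono b := [exists x in K, exists y in K, exists z in K,
  [&& uniq [:: x; y; z], g x y == b, g x z == b & g y z == b]].
have [|no_triangle] := boolP (mono true).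
  case/exists_inP=> x xK /exists_inP[y yK /exists_inP[z zK]].
  case/and4P=> /(extend _ _ _ xK yK zK)[u sK] /eqP xy /eqP xz /eqP yz.
  by apply: (dominated_of_triangle F2 sK); rewrite fam2.
have [|no_gap] := boolP (mono false).
  case/exists_inP=> x xK /exists_inP[y yK /exists_inP[z zK]].
  case/and4P=> /(extend _ _ _ xK yK zK)[u sK] /eqP xy /eqP xz /eqP yz.
  apply: (@settle _ [:: 3; 4; 0; 1; 2] pair_orientation [::]
    [:: [:: 0; 1]; [:: 0; 2]; [:: 1; 2]] _ sK (fun n => size_bound F2 sK));
    last by lazy.
  by rewrite /= !fam2 /= xy xz yz.
have [||x y z|a [b [c [d [e [sK [ac bd ce ad be]]]]]]] :=
    @ramsey_pentagon _ g (enum K).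
- exact: enum_uniq.
- by rewrite -cardE.
- rewrite !mem_enum => xK yK zK xyz; apply/andP; split.
    move: no_gap; apply: contraNT; rewrite !negb_or => /and3P[xy xz yz].
    apply/exists_inP; exists x => //; apply/exists_inP; exists y => //.
    apply/exists_inP; exists z => //.
    by rewrite xyz (negbTE xy) (negbTE xz) (negbTE yz).
  move: no_triangle; apply: contraNN => /and3P[xy xz yz].
  apply/exists_inP; exists x => //; apply/exists_inP; exists y => //.
  by apply/exists_inP; exists z => //; rewrite xyz xy xz yz.
apply: (@settle _ (iota 0 5) cyclic_orientation [::]
  [:: [:: 0; 2]; [:: 1; 3]; [:: 2; 4]; [:: 0; 3]; [:: 1; 4]] _ sK
  (fun n => size_bound F2 sK)); last by lazy.
by rewrite /= !fam2 /= ac bd ce ad be.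
Qed.

Lemma dominated_of_J_free : dominated.
Proof.
have F_subset B (BF : B \in F) := proper_sub (F_sub BF).
have [/exists_inP[B BF /eqP B4]|no4] := boolP [exists B in F, #|B| == 4].
  have [s sK sB] := listing_of_set (F_subset B BF) B4.
  by apply: (dominated_of_4set sK); rewrite /fam -sB.
have F3 B : B \in F -> #|B| <= 3.
  move=> BF; rewrite -ltnS ltn_neqAle (exists_inPn no4) //.
  by rewrite -ltnS -card_K proper_card ?F_sub.
have [/exists_inP[B BF /eqP B3]|no3] := boolP [exists B in F, #|B| == 3].
  have [s sK sB] := listing_of_set (F_subset B BF) B3.
  by apply: (dominated_of_3set F3 sK); rewrite /fam -sB.
apply: dominated_of_pairs => B BF.
by rewrite -ltnS ltn_neqAle (exists_inPn no3) // F3.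
Qed.

End Families.

(** * Split graphs with a clique of size five *)

Section SplitGraphs.

Variables (G : sgraph) (K : {set G}).
Hypothesis clK : clique K.
Hypothesis indS : independent (~: K).

Definition nbr (v : G) : {set G} := [set x | adj v x].

Definition nbr_family : {set {set G}} := [set nbr v | v in ~: K].

Lemma nbr_sub (v : G) : v \notin K -> nbr v \subset K.
Proof.
move=> vS; apply/subsetP=> x; rewrite inE => vx; apply/negPn/negP=> xS.
by have := indS (x := v) (y := x); rewrite !inE vx => /(_ vS xS).
Qed.

(** An outside vertex adjacent to all of [K] would extend it to a [K_6]. *)
Lemma nbr_family_proper (B : {set G}) : #|K| = 5 -> free_of F5sp G ->
  B \in nbr_family -> B \proper K.
Proof.
move=> card_K G_free /imsetP[v]; rewrite inE => vS ->.
rewrite properEneq nbr_sub // andbT; apply/eqP=> nbrK.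
have vK x : x \in K -> adj v x by rewrite -nbrK inE.
case: (G_free _ F5sp_K6); apply: (large_clique_induced (K := v |: K)).
  move=> x y /setU1P[->|xK] /setU1P[->|yK]; rewrite ?eqxx // => xy.
  - exact: vK.
  - by rewrite adj_sym vK.
  - exact: clK.
by rewrite cardsU1 vS card_K.
Qed.

(** The members of a copy of the family of [J_i] are neighborhoods of outside
    vertices, which are distinct because the neighborhoods in [J_i] are; together
    with [K] they induce [J_i]. *)
Lemma J_free_nbr_family (x0 : G) : #|K| = 5 -> free_of F5sp G ->
  J_free x0 K nbr_family.
Proof.
move=> card_K G_free N s NJ sK; apply/negP=> /allP famN.
suff [A isoA] : exists A : {set G}, isomorphic (induced A) (split_from 5 N).
  have le_i : 1 <= (index N J_neighborhoods).+1 <= 12.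
    by have := NJ; rewrite -index_mem.
  by apply: (G_free _ (F5sp_J le_i)); exists A; rewrite /J /= nth_index.
have s5 := size_listing card_K sK; have s_uniq := uniq_listing sK.
have /allP/(_ N NJ)/andP[N_uniq /allP N_sorted] :
  all (fun M : seq (seq nat) => uniq M &&
    all (fun n : seq nat => n == [seq k <- iota 0 5 | k \in n]) M)
  J_neighborhoods by [].
have nth_s (k : nat) (n : seq nat) : n \in N -> k < 5 ->
    (nth x0 s k \in part x0 s n) = (k \in n).
  move=> nN lt5; rewrite inE; apply/mapP/idP=> [[j jn /eqP]|kn]; last by exists k.
  have lt_j : j < 5.
    by move: jn; rewrite (eqP (N_sorted n nN)) mem_filter mem_iota => /andP[].
  by rewrite nth_uniq ?s5 // => /eqP->.
have nN (j : 'I_(size N)) : nth [::] N j \in N by apply: mem_nth.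
have wP (j : 'I_(size N)) :
    exists v, (v \notin K) && (nbr v == part x0 s (nth [::] N j)).
  have /imsetP[v] := famN _ (nN j); rewrite inE => vS nbrv.
  by exists v; rewrite vS nbrv eqxx.
pose w j := xchoose (wP j).
have wS j : w j \notin K by have /andP[] := xchooseP (wP j).
have nbr_w j : nbr (w j) = part x0 s (nth [::] N j).
  by have /andP[_ /eqP] := xchooseP (wP j).
have w_inj : injective w.
  move=> j k wjk; apply/val_inj/eqP; rewrite -(nth_uniq [::] _ _ N_uniq) ?ltn_ord //.
  rewrite (eqP (N_sorted _ (nN j))) (eqP (N_sorted _ (nN k))).
  apply/eqP/eq_in_filter => l; rewrite mem_iota => l5.
  by rewrite -!nth_s // -!nbr_w wjk.
have sP (k : 'I_5) : nth x0 s k \in K.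
  by rewrite -(mem_listing sK) mem_nth ?s5.
have s_inj (k l : 'I_5) : nth x0 s k = nth x0 s l -> k = l.
  by move=> /eqP; rewrite nth_uniq ?s5 // => /eqP/val_inj.
pose h (u : split_from 5 N) : G :=
  match u with inl k => nth x0 s k | inr j => w j end.
have h_inj : injective h.
  move=> [k|j] [l|m] /=; first by move/s_inj->.
  - by move=> kw; have := sP k; rewrite kw (negbTE (wS m)).
  - by move=> wl; have := sP l; rewrite -wl (negbTE (wS j)).
  - by move/w_inj->.
apply: (embedding_induced h_inj) => -[k|j] [l|m] /=.
- have [->|kl] := eqVneq k l; first exact: adj_irr.
  by apply: clK => //; apply: contra kl => /eqP/s_inj->.
- by rewrite adj_sym -(nth_s _ _ (nN m)) // -nbr_w inE.
- by rewrite -(nth_s _ _ (nN j)) // -nbr_w inE.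
- by apply/negbTE/indS; rewrite inE wS.
Qed.

(** An outside vertex gets the color of a vertex of [K] that dominates its
    neighborhood; a bicolored path would need two opposite arcs. *)
Lemma star_colorable_of_dominated (x0 : G) : #|K| = 5 ->
  dominated x0 K nbr_family -> star_colorable G 5.
Proof.
move=> card_K [s [out [sK outP] dom]].
have dominatorP v : v \notin K ->
    exists i : 'I_5, nbr v \subset part x0 s (nth [::] out i).
  move=> vS; have [|i lti sub] := dom (nbr v); first by rewrite imset_f // inE.
  by exists (Ordinal lti).
pose f (v : G) : 'I_5 := if v \in K then inord (index v s)
  else odflt ord0 [pick i : 'I_5 | nbr v \subset part x0 s (nth [::] out i)].
have index_lt x : x \in K -> index x s < 5.
  by rewrite -(mem_listing sK) -(size_listing card_K sK) index_mem.
have fK x : x \in K -> f x = index x s :> nat.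
  by move=> xK; rewrite /f xK inordK // index_lt.
have fS v y : v \notin K -> adj v y -> y \in K -> index y s \in nth [::] out (f v).
  move=> vS vy yK; rewrite /f (negbTE vS); case: pickP => [i sub|none]; last first.
    by have [i] := dominatorP v vS; rewrite none.
  have : y \in nbr v by rewrite inE.
  move/(subsetP sub); rewrite inE => /mapP[k kout ->].
  rewrite index_uniq ?(uniq_listing sK) // (size_listing card_K sK).
  exact: orientations_lt5 outP kout.
exists f; apply: (star_coloring_split clK indS).
  move=> x y xK yK /(congr1 val); rewrite /= !fK // => /(congr1 (nth x0 s)).
  by rewrite !nth_index ?(mem_listing sK).
move=> u v x y uS vS xK yK uy vx fux fvy.
have := fS u y uS uy yK; have := fS v x vS vx xK.
rewrite fux fvy !fK // => xy /(orientations_asym outP).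
by rewrite xy.
Qed.

End SplitGraphs.

Theorem proposition3p12 (G : sgraph) :
  split_graph G -> (star_colorable G 5 <-> free_of F5sp G).
Proof.
case=> K [S [KS KIS clK indS]].
have S_K : S = ~: K.
  apply/setP=> x; have := congr1 (fun A : {set G} => x \in A) KS.
  have := congr1 (fun A : {set G} => x \in A) KIS.
  by rewrite !inE; case: (x \in K); case: (x \in S).
rewrite {S KS KIS}S_K in indS.
split=> [G_col H HF [A isoA]|G_free].
  have := star_colorable_induced isoA G_col.
  case: HF => [|i le_i]; first exact: complete_not_star_colorable.
  exact: J_not_star_colorable.
have [le4|gt4] := leqP #|K| 4; first exact: star_colorable_small_clique le4.
have [le5|gt5] := leqP #|K| 5; last first.
  by case: (G_free _ F5sp_K6); apply: large_clique_induced gt5.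
have card_K : #|K| = 5 by apply/eqP; rewrite eqn_leq le5.
have [x0 _] : exists x0, x0 \in K by apply/card_gt0P; rewrite card_K.
apply: (star_colorable_of_dominated (x0 := x0) clK indS card_K).
apply: dominated_of_J_free => //.
  by move=> B; apply: nbr_family_proper.
exact: J_free_nbr_family.
Qed.
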